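(* Let $\lambda\in\widehat{G}$. Then the Verma module $M(\lambda)$ is a projective object in $\mathcal{W}$.
   Context: $k$ is a field, $G$ a group, $\widehat{G}$ the group of characters $G\to k^{\times}$, $\chi\in\widehat{G}$, and $a\in Z(G)$ with $\chi(a)\neq 1$. $H=kG(\chi^{-1},a,0)$ is the Hopf algebra generated as an algebra by $G$ and $x$ with relations $xg=\chi^{-1}(g)gx$ ($g\in G$), having $k$-basis $\{gx^i\mid g\in G,i\geq 0\}$, with $\Delta(x)=x\otimes a+1\otimes x$, $\varepsilon(x)=0$, $S(x)=-xa^{-1}$, and each $g\in G$ group-like; $H_0=kG$. For an $H$-module $M$ and $\lambda\in\widehat{G}$, $M_{(\lambda)}=\{v\in M\mid g\cdot v=\lambda(g)v\ \forall g\in G\}$. $M$ is a weight module if $M=\bigoplus_{\lambda\in\widehat{G}}M_{(\lambda)}$; $\mathcal{W}$ is the full subcategory of left $H$-modules consisting of all (not necessarily finite dimensional) weight modules. $M(\lambda)=H\otimes_{H_0}V_{\lambda}$, where $V_{\lambda}$ is the one-dimensional $kG$-module of weight $\lambda$. With $v_{\lambda}=1\otimes v$ for a fixed $0\neq v\in V_\lambda$, $M(\lambda)$ has $k$-basis $\{x^i\cdot v_{\lambda}\mid i\geq 0\}$ and $g\cdot(x^i\cdot v_{\lambda})=\chi^i(g)\lambda(g)x^i\cdot v_{\lambda}$ for $g\in G$. *)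

(* Defs.v *)
From HB Require Import structures.
From mathcomp Require Import all_boot all_order all_algebra.
From mathcomp Require Import finmap generic_quotient ring_quotient.
From mathcomp.multinomials Require Import monalg.
From mathcomp.classical Require Import boolp.

Set Implicit Arguments.
Unset Strict Implicit.
Unset Printing Implicit Defensive.

Import GRing.Theory.
Local Open Scope ring_scope.

(* Homomorphisms G -> k^x, seen as nonvanishing multiplicative maps to k. *)
Record character (k : fieldType) (G : groupType) := Character {
  char_val :> G -> k;
  charM : forall g h, char_val (g * h)%g = char_val g * char_val h;
  char_neq0 : forall g, char_val g != 0
}.

Section CharacterTheory.
Variables (k : fieldType) (G : groupType).
Implicit Types chi : character k G.

Lemma char1 chi : chi 1%g = 1.
Proof. by apply: (mulfI (char_neq0 chi 1%g)); rewrite -charM mulg1 mulr1. Qed.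

Fact char_inv_M chi (g h : G) :
  (chi (g * h)%g)^-1 = (chi g)^-1 * (chi h)^-1.
Proof. by rewrite charM invfM. Qed.

Fact char_inv_neq0 chi (g : G) : (chi g)^-1 != 0.
Proof. by rewrite invr_eq0 char_neq0. Qed.

Definition char_inv chi : character k G :=
  Character (char_inv_M chi) (char_inv_neq0 chi).

End CharacterTheory.

Fact congrZD (k : fieldType) (W : lmodType k) c (u v w : W) :
  u = v -> c *: u + w = c *: v + w.
Proof. by move->. Qed.

(* Algebras with a basis (e_p) indexed by a monoid and a multiplication of   *)
(* the form e_p e_q = c(p, q) e_(pq) with c(p, q) in k. The group algebra    *)
(* kG, the algebra H and its tensor powers are all of this form.             *)
Record twist (k : fieldType) := Twist {
  tw_index : choiceType;
  tw_one : tw_index;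
  tw_mul : tw_index -> tw_index -> tw_index;
  tw_coef : tw_index -> tw_index -> k;
  tw_mulA : associative tw_mul;
  tw_mul1 : left_id tw_one tw_mul;
  tw_1mul : right_id tw_one tw_mul;
  tw_coefA : forall p q r,
    tw_coef q r * tw_coef p (tw_mul q r) = tw_coef p q * tw_coef (tw_mul p q) r;
  tw_coef1 : forall p, tw_coef tw_one p = 1;
  tw_1coef : forall p, tw_coef p tw_one = 1
}.

Definition talg (k : fieldType) (T : twist k) : Type := {malg k[tw_index T]}.

HB.instance Definition _ (k : fieldType) (T : twist k) :=
  GRing.Lmodule.on (talg T).

HB.lock Definition tb (k : fieldType) (T : twist k) (p : tw_index T) : talg T :=
  << 1 *g p >>.
Arguments tb {k T} p.

(* The linear extension of a map defined on the basis. *)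
HB.lock Definition tlin (k : fieldType) (T : twist k) (W : lmodType k)
    (f : tw_index T -> W) (u : talg T) : W :=
  \sum_(p <- msupp u) u@_p *: f p.
Arguments tlin {k T W} f u.

HB.lock Definition tmul (k : fieldType) (T : twist k) (u v : talg T) : talg T :=
  tlin (fun p => tlin (fun q => tw_coef p q *: tb (tw_mul p q)) v) u.
Arguments tmul {k T} u v.

Section TwistedAlgebra.
Variables (k : fieldType) (T : twist k).
Local Notation P := (tw_index T).
Implicit Types (u v w : talg T) (p q : P).

Section LinearExtension.
Variables (W : lmodType k) (f : P -> W).

Lemma tlinw (d : {fset P}) u : (msupp u `<=` d)%fset ->
  tlin f u = \sum_(p <- d) u@_p *: f p.
Proof.
move=> ud; rewrite unlock; apply: big_fset_incl => // p _ /mcoeff_outdom ->.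
by rewrite scale0r.
Qed.

Fact tlin_is_linear : linear (tlin f).
Proof.
move=> c u v; set d := (msupp u `|` msupp v)%fset.
have su : (msupp u `<=` d)%fset by rewrite fsubsetUl.
have sv : (msupp v `<=` d)%fset by rewrite fsubsetUr.
have suv : (msupp (c *: u + v) `<=` d)%fset.
  apply: fsubset_trans (msuppD_le _ _) _.
  by apply: fsetSU; apply: msuppZ_le.
rewrite (tlinw suv) (tlinw su) (tlinw sv) scaler_sumr -big_split /=.
by apply: eq_bigr => p _; rewrite mcoeffD mcoeffZ scalerDl scalerA.
Qed.

HB.instance Definition _ :=
  GRing.isLinear.Build k (talg T) W _ (tlin f) tlin_is_linear.

Lemma tlinE p : tlin f (tb p) = f p.
Proof. by rewrite tb.unlock (tlinw msuppU_le) big_seq_fset1 mcoeffUU scale1r. Qed.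

End LinearExtension.

Lemma eq_tlin (W : lmodType k) (f h : P -> W) : f =1 h -> tlin f =1 tlin h.
Proof. by move=> fh u; rewrite unlock; apply: eq_bigr => p _; rewrite fh. Qed.

Lemma tlin_linear_fun (W : lmodType k) c (f h : P -> W) u :
  tlin (fun p => c *: f p + h p) u = c *: tlin f u + tlin h u.
Proof.
rewrite unlock scaler_sumr -big_split /=; apply: eq_bigr => p _.
by rewrite scalerDr !scalerA mulrC.
Qed.

Lemma talgE u : u = \sum_(p <- msupp u) u@_p *: tb p.
Proof.
rewrite {1}[u]monalgE; apply: eq_bigr => p _; apply/malgP => q; rewrite tb.unlock.
by rewrite mcoeffZ !mcoeffU mulrnAr mulr1.
Qed.

Lemma talg_ind (Q : talg T -> Prop) :
  Q 0 -> (forall c p u, Q u -> Q (c *: tb p + u)) -> forall u, Q u.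
Proof.
move=> Q0 Qc u; rewrite [u]talgE.
by elim: (enum_fset _) => [|p s IHs]; rewrite ?big_nil ?big_cons //; apply: Qc.
Qed.

Lemma tmulbb p q : tmul (tb p) (tb q) = tw_coef p q *: tb (tw_mul p q).
Proof. by rewrite tmul.unlock !tlinE. Qed.

Lemma tmulDl : left_distributive (@tmul k T) +%R.
Proof. by move=> u v w; rewrite tmul.unlock linearD. Qed.

Lemma tmulZl c u v : tmul (c *: u) v = c *: tmul u v.
Proof. by rewrite tmul.unlock linearZ. Qed.

Lemma tmul_linear u : linear (tmul u).
Proof.
move=> c v w; rewrite tmul.unlock -tlin_linear_fun.
by apply: eq_tlin => p; rewrite linearP.
Qed.

Lemma tmulDr : right_distributive (@tmul k T) +%R.
Proof. by move=> u v w; have := tmul_linear u 1 v w; rewrite !scale1r. Qed.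

Lemma tmul0l u : tmul 0 u = 0.
Proof. by rewrite tmul.unlock linear0. Qed.

Lemma tmul0r u : tmul u 0 = 0.
Proof. by apply: (addIr (tmul u 0)); rewrite -tmulDr !add0r. Qed.

Lemma tmulZr c u v : tmul u (c *: v) = c *: tmul u v.
Proof. by have := tmul_linear u c v 0; rewrite tmul0r !addr0. Qed.

Fact tmulA : associative (@tmul k T).
Proof.
move=> u v w.
elim/talg_ind: u => [|c p u IHu]; first by rewrite !tmul0l.
rewrite !tmulDl !tmulZl IHu; apply: congrZD.
elim/talg_ind: v {IHu} => [|d q v IHv]; first by rewrite !(tmul0l, tmul0r).
rewrite !(tmulDl, tmulDr) !(tmulZl, tmulZr) IHv; apply: congrZD.
elim/talg_ind: w {IHv} => [|e r w IHw]; first by rewrite !tmul0r.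
rewrite !tmulDr !tmulZr IHw; apply: congrZD.
by rewrite !tmulbb tmulZl tmulZr !tmulbb !scalerA tw_coefA tw_mulA.
Qed.

Fact tmul1l : left_id (tb (tw_one T)) tmul.
Proof.
elim/talg_ind=> [|c p u IHu]; first by rewrite tmul0r.
by rewrite tmulDr tmulZr IHu tmulbb tw_coef1 scale1r tw_mul1.
Qed.

Fact tmul1r : right_id (tb (tw_one T)) tmul.
Proof.
elim/talg_ind=> [|c p u IHu]; first by rewrite tmul0l.
by rewrite tmulDl tmulZl IHu tmulbb tw_1coef scale1r tw_1mul.
Qed.

Fact tb1_neq0 : tb (tw_one T) != 0.
Proof. by rewrite tb.unlock monalgU_eq0 oner_eq0. Qed.

HB.instance Definition _ := GRing.Zmodule_isNzRing.Build (talg T)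
  tmulA tmul1l tmul1r tmulDl tmulDr tb1_neq0.

Fact tscaleAl c u v : c *: (u * v) = (c *: u) * v.
Proof. by rewrite -[RHS]/(tmul _ _) tmulZl. Qed.

HB.instance Definition _ := GRing.Lmodule_isLalgebra.Build k (talg T) tscaleAl.

Fact tscaleAr c u v : c *: (u * v) = u * (c *: v).
Proof. by rewrite -[RHS]/(tmul _ _) tmulZr. Qed.

HB.instance Definition _ := GRing.Lalgebra_isAlgebra.Build k (talg T) tscaleAr.

Lemma tbM p q : tb p * tb q = tw_coef p q *: tb (tw_mul p q).
Proof. exact: tmulbb. Qed.

Lemma tb1 : tb (tw_one T) = 1. Proof. by []. Qed.

(* A linear extension is an algebra morphism as soon as it is multiplicative *)
(* on the basis.                                                             *)
Lemma tlin_monoid_morphism (A : algType k) (f : P -> A) :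
  f (tw_one T) = 1 ->
  (forall p q, f p * f q = tw_coef p q *: f (tw_mul p q)) ->
  monoid_morphism (tlin f).
Proof.
move=> f1 fM; split=> [|u v]; first by rewrite -tb1 tlinE.
elim/talg_ind: u => [|c p u IHu]; first by rewrite !(mul0r, linear0).
rewrite mulrDl !linearD /= mulrDl IHu; congr (_ + _).
rewrite -scalerAl !linearZ /= -scalerAl; congr (_ *: _).
elim/talg_ind: v {IHu} => [|d q v IHv]; first by rewrite !(mulr0, linear0).
rewrite mulrDr !linearD /= mulrDr IHv; congr (_ + _).
rewrite -scalerAr !linearZ /= -scalerAr; congr (_ *: _).
by rewrite tbM linearZ /= !tlinE fM.
Qed.

Lemma tlin_ext (W : lmodType k) (f h : {linear talg T -> W}) :
  (forall p, f (tb p) = h (tb p)) -> f =1 h.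
Proof.
move=> fh; elim/talg_ind=> [|c p u IHu]; first by rewrite !linear0.
by rewrite !linearD !linearZ /= fh IHu.
Qed.

End TwistedAlgebra.

(* T (x) U, with basis the e_p (x) e_q. *)
Section TensorTwist.
Variables (k : fieldType) (T U : twist k).

Let tmulP (p q : tw_index T * tw_index U) := (tw_mul p.1 q.1, tw_mul p.2 q.2).
Let tcoefP (p q : tw_index T * tw_index U) :=
  tw_coef p.1 q.1 * tw_coef p.2 q.2.

Fact tens_mulA : associative tmulP.
Proof. by move=> p q r; rewrite /tmulP !tw_mulA. Qed.
Fact tens_mul1 : left_id (tw_one T, tw_one U) tmulP.
Proof. by case=> p q; rewrite /tmulP !tw_mul1. Qed.
Fact tens_1mul : right_id (tw_one T, tw_one U) tmulP.
Proof. by case=> p q; rewrite /tmulP !tw_1mul. Qed.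
Fact tens_coefA p q r :
  tcoefP q r * tcoefP p (tmulP q r) = tcoefP p q * tcoefP (tmulP p q) r.
Proof. by rewrite /tcoefP mulrACA !tw_coefA mulrACA. Qed.
Fact tens_coef1 p : tcoefP (tw_one T, tw_one U) p = 1.
Proof. by rewrite /tcoefP !tw_coef1 mulr1. Qed.
Fact tens_1coef p : tcoefP p (tw_one T, tw_one U) = 1.
Proof. by rewrite /tcoefP !tw_1coef mulr1. Qed.

Definition tensT : twist k :=
  Twist tens_mulA tens_mul1 tens_1mul tens_coefA tens_coef1 tens_1coef.

End TensorTwist.

HB.lock Definition tens (k : fieldType) (T U : twist k)
    (u : talg T) (v : talg U) : talg (tensT T U) :=
  tlin (fun p => tlin (fun q => tb (T := tensT T U) (p, q)) v) u.
Arguments tens {k T U} u v.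

Section TensorTheory.
Variables (k : fieldType) (T U : twist k).

Lemma tensbb p q : tens (tb p) (tb q : talg U) = tb (T := tensT T U) (p, q).
Proof. by rewrite tens.unlock !tlinE. Qed.

Lemma tens_linearl (v : talg U) : linear (fun u : talg T => tens u v).
Proof. by move=> c u u'; rewrite tens.unlock linearP. Qed.

Lemma tens_linearr (u : talg T) : linear (@tens k T U u).
Proof.
move=> c v w; rewrite tens.unlock -tlin_linear_fun.
by apply: eq_tlin => p; rewrite linearP.
Qed.

HB.instance Definition _ u := GRing.isLinear.Build k (talg U) (talg (tensT T U)) _
  (@tens k T U u) (tens_linearr u).

Definition tensr (v : talg U) (u : talg T) := tens u v.
HB.instance Definition _ v := GRing.isLinear.Build k (talg T) (talg (tensT T U)) _
  (tensr v) (tens_linearl v).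

Implicit Types (u : talg T) (v : talg U).

Lemma tensZl c u v : tens (c *: u) v = c *: tens u v.
Proof. exact: (linearZZ (tensr v)). Qed.
Lemma tensDl u u' v : tens (u + u') v = tens u v + tens u' v.
Proof. exact: (linearD (tensr v)). Qed.
Lemma tens0l v : tens (0 : talg T) v = 0.
Proof. exact: (linear0 (tensr v)). Qed.

Lemma tensM u u' v v' : tens u v * tens u' v' = tens (u * u') (v * v').
Proof.
elim/talg_ind: u => [|c p u IHu]; first by rewrite !(mul0r, tens0l).
rewrite !(tensDl, mulrDl, tensZl) IHu -!scalerAl tensZl; apply: congrZD.
elim/talg_ind: u' {IHu} => [|d q u' IHu]; first by rewrite !(mulr0, tens0l).
rewrite !(tensDl, mulrDr, tensZl) IHu -!scalerAr tensZl; apply: congrZD.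
elim/talg_ind: v {IHu} => [|e r v IHv]; first by rewrite !(mul0r, linear0).
rewrite !(linearD, linearZ) /= !mulrDl linearD IHv -!scalerAl linearZ /=.
apply: congrZD.
elim/talg_ind: v' {IHv} => [|f s v' IHv]; first by rewrite !(mulr0, linear0).
rewrite !(linearD, linearZ) /= !mulrDr linearD IHv -!scalerAr linearZ /=.
apply: congrZD.
by rewrite !tensbb !tbM tensZl linearZ /= tensbb scalerA.
Qed.

Lemma tens1 : tens (1 : talg T) (1 : talg U) = 1.
Proof. by rewrite -!tb1 tensbb. Qed.

End TensorTheory.

Section TensorMaps.
Variable k : fieldType.

(* u (x) v |-> f u (x) h v *)
Definition tens_map (T U T' U' : twist k)
    (f : talg T -> talg T') (h : talg U -> talg U') :
    talg (tensT T U) -> talg (tensT T' U') :=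
  tlin (fun p : tw_index (tensT T U) => tens (f (tb p.1)) (h (tb p.2))).

Definition tens_assoc (T U V : twist k) :
    talg (tensT (tensT T U) V) -> talg (tensT T (tensT U V)) :=
  tlin (fun p : tw_index (tensT (tensT T U) V) =>
    tb (T := tensT T (tensT U V)) (p.1.1, (p.1.2, p.2))).

(* u (x) v |-> f u * h v *)
Definition tens_mul (T U : twist k) (A : algType k)
    (f : talg T -> A) (h : talg U -> A) : talg (tensT T U) -> A :=
  tlin (fun p : tw_index (tensT T U) => f (tb p.1) * h (tb p.2)).

HB.instance Definition _ (T U T' U' : twist k)
    (f : talg T -> talg T') (h : talg U -> talg U') :=
  GRing.Linear.copy (tens_map f h) (tlin _).
HB.instance Definition _ (T U V : twist k) :=
  GRing.Linear.copy (@tens_assoc T U V) (tlin _).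
HB.instance Definition _ (T U : twist k) (A : algType k)
    (f : talg T -> A) (h : talg U -> A) :=
  GRing.Linear.copy (tens_mul f h) (tlin _).

Lemma tensPl (T U : twist k) c (u u' : talg T) (v : talg U) :
  tens (c *: u + u') v = c *: tens u v + tens u' v.
Proof. by rewrite tensDl tensZl. Qed.

Lemma tens_mapE (T U T' U' : twist k) (f : {linear talg T -> talg T'})
    (h : {linear talg U -> talg U'}) u v :
  tens_map f h (tens u v) = tens (f u) (h v).
Proof.
elim/talg_ind: u => [|c p u IHu]; first by rewrite !(tens0l, linear0).
rewrite tensPl !linearP /= tensPl IHu; apply: congrZD.
elim/talg_ind: v {IHu} => [|d q v IHv]; first by rewrite !linear0.
rewrite !linearP /= IHv; apply: congrZD.
by rewrite tensbb /tens_map tlinE.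
Qed.

Lemma tens_mulE (T U : twist k) (A : algType k) (f : {linear talg T -> A})
    (h : {linear talg U -> A}) u v :
  tens_mul f h (tens u v) = f u * h v.
Proof.
elim/talg_ind: u => [|c p u IHu]; first by rewrite tens0l !linear0 mul0r.
rewrite tensPl !linearP /= IHu mulrDl -scalerAl; apply: congrZD.
elim/talg_ind: v {IHu} => [|d q v IHv]; first by rewrite !linear0 mulr0.
rewrite !linearP /= IHv mulrDr -scalerAr; apply: congrZD.
by rewrite tensbb /tens_mul tlinE.
Qed.

Lemma tens_mul_monoid_morphism (T U : twist k) (A : algType k)
    (f : {lrmorphism talg T -> A}) (h : {lrmorphism talg U -> A}) :
  (forall u v, f u * h v = h v * f u) -> monoid_morphism (tens_mul f h).
Proof.
move=> fh; apply: tlin_monoid_morphism => [|p q].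
  by rewrite /= !tb1 !rmorph1 mulr1.
rewrite mulrA -[_ * h _ * f _]mulrA -fh mulrA -rmorphM -mulrA -rmorphM !tbM /=.
by rewrite !linearZ /= -scalerAl -scalerAr scalerA.
Qed.

Lemma tens_assocE (T U V : twist k) (u : talg T) (v : talg U) (w : talg V) :
  tens_assoc (tens (tens u v) w) = tens u (tens v w).
Proof.
elim/talg_ind: u => [|c p u IHu]; first by rewrite !tens0l linear0.
rewrite !tensPl linearP /= IHu; apply: congrZD.
elim/talg_ind: v {IHu} => [|d q v IHv].
  by rewrite tens0l !linear0 tens0l linear0.
rewrite tensPl linearP /= tensPl !linearP /= IHv; apply: congrZD.
elim/talg_ind: w {IHv} => [|e r w IHw]; first by rewrite !linear0.
rewrite !linearP /= IHw; apply: congrZD.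
by rewrite !tensbb /tens_assoc tlinE.
Qed.

Fact tens_map_monoid_morphism (T U T' U' : twist k)
    (f : {lrmorphism talg T -> talg T'}) (h : {lrmorphism talg U -> talg U'}) :
  monoid_morphism (tens_map f h).
Proof.
apply: tlin_monoid_morphism => [|p q]; first by rewrite /= !tb1 !rmorph1 tens1.
rewrite tensM -!rmorphM !tbM /= !linearZ /= tensZl scalerA.
by rewrite -[X in X *: _]mulrC.
Qed.
HB.instance Definition _ (T U T' U' : twist k)
    (f : {lrmorphism talg T -> talg T'}) (h : {lrmorphism talg U -> talg U'}) :=
  GRing.isMonoidMorphism.Build (talg (tensT T U)) (talg (tensT T' U'))
    (tens_map f h) (tens_map_monoid_morphism f h).

Fact tens_assoc_monoid_morphism (T U V : twist k) :
  monoid_morphism (@tens_assoc T U V).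
Proof.
apply: tlin_monoid_morphism => [|p q]; first by rewrite -tb1.
by rewrite tbM /= -mulrA.
Qed.
HB.instance Definition _ (T U V : twist k) :=
  GRing.isMonoidMorphism.Build (talg (tensT (tensT T U) V))
    (talg (tensT T (tensT U V))) (@tens_assoc T U V)
    (@tens_assoc_monoid_morphism T U V).

(* The composition of the counit with the unit map k -> A. *)
Definition unit_counit (T : twist k) (e : {lrmorphism talg T -> k^o})
    (u : talg T) : talg T := (e u : k)%:A.

Fact unit_counit_is_linear (T : twist k) (e : {lrmorphism talg T -> k^o}) :
  linear (unit_counit e).
Proof.
by move=> c u v; rewrite /unit_counit linearP scalerDl -scalerA.
Qed.
HB.instance Definition _ (T : twist k) (e : {lrmorphism talg T -> k^o}) :=
  GRing.isLinear.Build k (talg T) (talg T) _ (unit_counit e)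
    (unit_counit_is_linear e).

Fact unit_counit_monoid_morphism (T : twist k)
  (e : {lrmorphism talg T -> k^o}) : monoid_morphism (unit_counit e).
Proof.
split=> [|u v]; first by rewrite /unit_counit rmorph1 scale1r.
by rewrite /unit_counit rmorphM -scalerAl mul1r scalerA.
Qed.
HB.instance Definition _ (T : twist k) (e : {lrmorphism talg T -> k^o}) :=
  GRing.isMonoidMorphism.Build (talg T) (talg T) (unit_counit e)
    (unit_counit_monoid_morphism e).

End TensorMaps.

(* Hopf algebra structures on the algebras talg T. *)
Record hopf (k : fieldType) := Hopf {
  hopf_twist : twist k;
  comul : {lrmorphism talg hopf_twist -> talg (tensT hopf_twist hopf_twist)};
  counit : {lrmorphism talg hopf_twist -> k^o};
  antipode : {linear talg hopf_twist -> talg hopf_twist};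
  comulA : forall u,
    tens_assoc (tens_map comul idfun (comul u))
      = tens_map idfun comul (comul u);
  comul_counitl : forall u,
    tens_mul (unit_counit counit) idfun (comul u) = u;
  comul_counitr : forall u,
    tens_mul idfun (unit_counit counit) (comul u) = u;
  antipodel : forall u, tens_mul antipode idfun (comul u) = unit_counit counit u;
  antipoder : forall u, tens_mul idfun antipode (comul u) = unit_counit counit u
}.

Definition hopf_alg (k : fieldType) (H : hopf k) : algType k :=
  talg (hopf_twist H).

Section GroupAlgebra.
Variables (k : fieldType) (G : groupType).

Fact grp_coefA (p q r : G) : 1 * 1 = 1 * 1 :> k. Proof. by []. Qed.
Fact grp_coef1 (p : G) : 1 = 1 :> k. Proof. by []. Qed.

Definition grpT : twist k :=
  @Twist k G 1%g (fun g h => (g * h)%g) (fun _ _ => 1) (@mulgA G) (@mul1g G)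
    (@mulg1 G) grp_coefA grp_coef1 grp_coef1.

End GroupAlgebra.

(* The algebra generated by G and x with relations x g = eta(g) g x. The     *)
(* index (g, i) stands for g x^i, so that                                    *)
(* (g x^i) (h x^j) = eta(h)^i (g h) x^(i + j).                               *)
Section OreTwist.
Variables (k : fieldType) (G : groupType) (eta : character k G).
Implicit Types p q r : G * nat.

Definition ore_mul p q : G * nat := ((p.1 * q.1)%g, (p.2 + q.2)%N).
Definition ore_coef p q : k := eta q.1 ^+ p.2.

Fact ore_mulA : associative ore_mul.
Proof. by move=> p q r; rewrite /ore_mul mulgA addnA. Qed.
Fact ore_mul1 : left_id (1%g, 0%N) ore_mul.
Proof. by case=> g i; rewrite /ore_mul mul1g. Qed.
Fact ore_1mul : right_id (1%g, 0%N) ore_mul.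
Proof. by case=> g i; rewrite /ore_mul mulg1 addn0. Qed.
Fact ore_coefA p q r :
  ore_coef q r * ore_coef p (ore_mul q r)
    = ore_coef p q * ore_coef (ore_mul p q) r.
Proof. by rewrite /ore_coef charM exprMn exprD mulrCA; congr (_ * _); rewrite mulrC. Qed.
Fact ore_coef1 p : ore_coef (1%g, 0%N) p = 1. Proof. by []. Qed.
Fact ore_1coef p : ore_coef p (1%g, 0%N) = 1.
Proof. by rewrite /ore_coef char1 expr1n. Qed.

Definition oreT : twist k :=
  Twist ore_mulA ore_mul1 ore_1mul ore_coefA ore_coef1 ore_1coef.

Definition ore_grp (g : G) : talg oreT := tb (T := oreT) (g, 0%N).
Definition ore_x : talg oreT := tb (T := oreT) (1%g, 1%N).

Lemma ore_grpM g h : ore_grp (g * h)%g = ore_grp g * ore_grp h.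
Proof. by rewrite tbM /= /ore_coef expr0 scale1r. Qed.

Lemma ore_grp1 : ore_grp 1%g = 1.
Proof. by []. Qed.

Lemma ore_grpV g : ore_grp g^-1%g * ore_grp g = 1.
Proof. by rewrite -ore_grpM mulVg. Qed.

Lemma ore_grpVr g : ore_grp g * ore_grp g^-1%g = 1.
Proof. by rewrite -ore_grpM mulgV. Qed.

Lemma ore_xg g : ore_x * ore_grp g = eta g *: (ore_grp g * ore_x).
Proof.
by rewrite !tbM /= /ore_coef expr0 /ore_mul /= mulg1 mul1g expr1 scale1r.
Qed.

Lemma ore_basis g i : tb (T := oreT) (g, i) = ore_grp g * ore_x ^+ i.
Proof.
elim: i => [|i IHi]; first by rewrite mulr1.
rewrite exprSr mulrA -IHi tbM /= /ore_coef char1 expr1n scale1r.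
by rewrite /ore_mul /= mulg1 addn1.
Qed.

(* Realizations of the generators and relations in an algebra. *)
Record ore_map (A : algType k) := OreMap {
  om_grp : G -> A;
  om_x : A;
  om_grp1 : om_grp 1%g = 1;
  om_grpM : forall g h, om_grp (g * h)%g = om_grp g * om_grp h;
  om_xg : forall g, om_x * om_grp g = eta g *: (om_grp g * om_x)
}.

Section Presentation.
Variable A : algType k.

Definition ore_lift (m : ore_map A) : talg oreT -> A :=
  tlin (fun p : tw_index oreT => om_grp m p.1 * om_x m ^+ p.2).

HB.instance Definition _ (m : ore_map A) :=
  GRing.Linear.copy (ore_lift m) (tlin _).

Lemma om_xng (m : ore_map A) g i :
  om_x m ^+ i * om_grp m g = eta g ^+ i *: (om_grp m g * om_x m ^+ i).
Proof.
elim: i => [|i IHi]; first by rewrite mul1r mulr1 scale1r.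
rewrite exprS -mulrA IHi -scalerAr [in LHS]mulrA om_xg.
by rewrite -scalerAl scalerA -mulrA -exprSr.
Qed.

Fact ore_lift_monoid_morphism (m : ore_map A) : monoid_morphism (ore_lift m).
Proof.
apply: tlin_monoid_morphism => [|[g i] [h j]] /=.
  by rewrite om_grp1 mulr1.
rewrite -mulrA [om_x m ^+ i * _]mulrA om_xng om_grpM exprD.
by rewrite -!scalerAl -!scalerAr !mulrA.
Qed.
HB.instance Definition _ (m : ore_map A) :=
  GRing.isMonoidMorphism.Build (talg oreT) A (ore_lift m)
    (ore_lift_monoid_morphism m).

Lemma ore_liftg (m : ore_map A) g : ore_lift m (ore_grp g) = om_grp m g.
Proof. by rewrite /ore_lift tlinE mulr1. Qed.

Lemma ore_liftx (m : ore_map A) : ore_lift m ore_x = om_x m.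
Proof. by rewrite /ore_lift tlinE /= om_grp1 mul1r. Qed.

Lemma ore_ext (f h : {lrmorphism talg oreT -> A}) :
  (forall g, f (ore_grp g) = h (ore_grp g)) -> f ore_x = h ore_x -> f =1 h.
Proof.
move=> fhg fhx; apply: tlin_ext => -[g i].
by rewrite ore_basis !rmorphM !rmorphXn /= fhg fhx.
Qed.

End Presentation.
End OreTwist.

(* The Hopf algebra kG(eta, a, 0). *)
Section HopfOre.
Variables (k : fieldType) (G : groupType) (eta : character k G) (a : G).
Hypothesis a_central : forall g : G, (a * g = g * a)%g.

Local Notation H := (talg (oreT eta)).
Local Notation gl := (ore_grp eta).
Local Notation x := (ore_x eta).

Let T2 := tensT (oreT eta) (oreT eta).

Fact comul_grp1 : tens (gl 1%g) (gl 1%g) = 1 :> talg T2.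
Proof. by rewrite ore_grp1 tens1. Qed.
Fact comul_grpM g h :
  tens (gl (g * h)%g) (gl (g * h)%g)
    = tens (gl g) (gl g) * tens (gl h) (gl h) :> talg T2.
Proof. by rewrite tensM !ore_grpM. Qed.
Fact comul_xg g :
  (tens x (gl a) + tens 1 x) * tens (gl g) (gl g)
    = eta g *: (tens (gl g) (gl g) * (tens x (gl a) + tens 1 x)) :> talg T2.
Proof.
rewrite mulrDl mulrDr !tensM mul1r mulr1 !ore_xg.
rewrite -(ore_grpM eta a) a_central ore_grpM.
by rewrite tensZl linearZ /= scalerDr.
Qed.

Fact counit_grp1 : 1 = 1 :> k^o. Proof. by []. Qed.
Fact counit_grpM (g h : G) : 1 = 1 * 1 :> k^o. Proof. by rewrite mulr1. Qed.
Fact counit_xg (g : G) : 0 * 1 = eta g *: (1 * 0) :> k^o.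
Proof. by rewrite mul0r mulr0 scaler0. Qed.

Definition ore_comul : H -> talg T2 :=
  ore_lift (OreMap comul_grp1 comul_grpM comul_xg).
HB.instance Definition _ := GRing.LRMorphism.copy ore_comul (ore_lift _).

Definition ore_counit : H -> k^o :=
  ore_lift (OreMap counit_grp1 counit_grpM counit_xg).
HB.instance Definition _ := GRing.LRMorphism.copy ore_counit (ore_lift _).

Definition ore_Sx : H := - (x * gl a^-1%g).

(* The anti-morphism mapping g to g^-1 and x to - x a^-1. *)
Definition ore_antipode : H -> H :=
  tlin (fun p : tw_index (oreT eta) => ore_Sx ^+ p.2 * gl p.1^-1%g).
HB.instance Definition _ := GRing.Linear.copy ore_antipode (tlin _).

Lemma ore_comulg g : ore_comul (gl g) = tens (gl g) (gl g).
Proof. exact: ore_liftg. Qed.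

Lemma ore_comulx : ore_comul x = tens x (gl a) + tens 1 x.
Proof. exact: ore_liftx. Qed.

Lemma ore_counitg g : ore_counit (gl g) = 1.
Proof. exact: ore_liftg. Qed.

Lemma ore_counitx : ore_counit x = 0.
Proof. exact: ore_liftx. Qed.

Lemma ore_ucg g : unit_counit ore_counit (gl g) = 1.
Proof. by rewrite /unit_counit /= ore_counitg scale1r. Qed.

Lemma ore_ucx : unit_counit ore_counit x = 0.
Proof. by rewrite /unit_counit /= ore_counitx scale0r. Qed.

Lemma ore_antipodeg g : ore_antipode (gl g) = gl g^-1%g.
Proof. by rewrite /ore_antipode tlinE mul1r. Qed.

Lemma ore_antipodex : ore_antipode x = - (x * gl a^-1%g).
Proof. by rewrite /ore_antipode tlinE /= invg1 ore_grp1 mulr1. Qed.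

Lemma ore_gSx g : gl g^-1%g * ore_Sx = eta g *: (ore_Sx * gl g^-1%g).
Proof.
have ac : (a^-1 * g^-1 = g^-1 * a^-1)%g by rewrite -!invgM a_central.
rewrite /ore_Sx mulrN mulNr -mulrA -ore_grpM ac ore_grpM !mulrA ore_xg.
by rewrite -scalerAl scalerN scalerA -charM mulgV char1 scale1r.
Qed.

Lemma ore_gSxn g i :
  gl g^-1%g * ore_Sx ^+ i = eta g ^+ i *: (ore_Sx ^+ i * gl g^-1%g).
Proof.
elim: i => [|i IHi]; first by rewrite mul1r mulr1 scale1r.
rewrite [in LHS]exprS mulrA ore_gSx -scalerAl -[in LHS]mulrA IHi -scalerAr.
by rewrite scalerA mulrA -!exprS.
Qed.

Lemma ore_antipodeM u v :
  ore_antipode (u * v) = ore_antipode v * ore_antipode u.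
Proof.
elim/talg_ind: u => [|c p u IHu]; first by rewrite mul0r !linear0 mulr0.
rewrite mulrDl -scalerAl !linearP /= IHu mulrDr -scalerAr; apply: congrZD.
elim/talg_ind: v {IHu} => [|d q v IHv]; first by rewrite mulr0 !linear0 mul0r.
rewrite mulrDr -scalerAr !linearP /= IHv mulrDl -scalerAl; apply: congrZD.
case: p q {IHv} => [g i] [h j]; rewrite tbM linearZ /= /ore_antipode !tlinE /= /ore_coef /=.
rewrite mulrA -[_ * ore_Sx ^+ i]mulrA ore_gSxn -scalerAr -scalerAl.
by rewrite invgM ore_grpM exprD !mulrA -exprD addnC exprD.
Qed.

Lemma ore_comulA u :
  tens_assoc (tens_map ore_comul idfun (ore_comul u))
    = tens_map idfun ore_comul (ore_comul u).
Proof.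
move: u; apply: (ore_ext
  (f := @tens_assoc k _ _ _ \o (tens_map ore_comul idfun \o ore_comul))
  (h := tens_map idfun ore_comul \o ore_comul)) => [g|] /=.
  by rewrite ore_comulg !tens_mapE /= ore_comulg tens_assocE.
rewrite ore_comulx !linearD /= !tens_mapE /= rmorph1 ore_comulx ore_comulg.
by rewrite tensDl linearD /= -tens1 !tens_assocE linearD /= addrA.
Qed.

Lemma ore_counitl u :
  tens_mul (unit_counit ore_counit) idfun (ore_comul u) = u.
Proof.
have comm (v w : H) :
    (unit_counit ore_counit) v * idfun w = idfun w * (unit_counit ore_counit) v.
  by rewrite /unit_counit /= mulr_algl mulr_algr.
have [E1 EM] := tens_mul_monoid_morphism
  (f := unit_counit ore_counit) (h := idfun) comm.
elim/talg_ind: u => [|c [g i] u IHu]; first by rewrite !linear0.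
rewrite !linearP /= IHu; apply: congrZD; rewrite ore_basis rmorphM /= EM.
congr (_ * _); first by rewrite ore_comulg tens_mulE /= ore_ucg mul1r.
elim: i => [|i IHi]; first by rewrite rmorph1 E1.
rewrite exprS rmorphM /= EM IHi ore_comulx linearD /= !tens_mulE /= ore_ucx.
by rewrite rmorph1 mul0r add0r mul1r.
Qed.

Lemma ore_counitr u :
  tens_mul idfun (unit_counit ore_counit) (ore_comul u) = u.
Proof.
have comm (v w : H) :
    idfun v * (unit_counit ore_counit) w = (unit_counit ore_counit) w * idfun v.
  by rewrite /unit_counit /= mulr_algl mulr_algr.
have [E1 EM] := tens_mul_monoid_morphism
  (f := idfun) (h := unit_counit ore_counit) comm.
elim/talg_ind: u => [|c [g i] u IHu]; first by rewrite !linear0.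
rewrite !linearP /= IHu; apply: congrZD; rewrite ore_basis rmorphM /= EM.
congr (_ * _); first by rewrite ore_comulg tens_mulE /= ore_ucg mulr1.
elim: i => [|i IHi]; first by rewrite rmorph1 E1.
rewrite exprS rmorphM /= EM IHi ore_comulx linearD /= !tens_mulE /= ore_ucx.
by rewrite ore_ucg mulr0 addr0 mulr1.
Qed.

Lemma tens_mul_antipodel (z : talg T2) (w t : H) :
  tens_mul ore_antipode idfun (z * tens w t)
    = ore_antipode w * tens_mul ore_antipode idfun z * t.
Proof.
elim/talg_ind: z => [|c [p q] z IHz].
  by rewrite mul0r !linear0 mulr0 mul0r.
rewrite mulrDl -scalerAl !linearP /= IHz mulrDr mulrDl -scalerAr -scalerAl.
apply: congrZD; rewrite -(tensbb (U := oreT eta)) tensM !tens_mulE /=.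
by rewrite ore_antipodeM !mulrA.
Qed.

Lemma tens_mul_antipoder (z : talg T2) (w t : H) :
  tens_mul idfun ore_antipode (tens w t * z)
    = w * tens_mul idfun ore_antipode z * ore_antipode t.
Proof.
elim/talg_ind: z => [|c [p q] z IHz].
  by rewrite mulr0 !linear0 mulr0 mul0r.
rewrite mulrDr -scalerAr !linearP /= IHz mulrDr mulrDl -scalerAr -scalerAl.
apply: congrZD; rewrite -(tensbb (U := oreT eta)) tensM !tens_mulE /=.
by rewrite ore_antipodeM !mulrA.
Qed.

Lemma ore_antipodel u :
  tens_mul ore_antipode idfun (ore_comul u) = unit_counit ore_counit u.
Proof.
elim/talg_ind: u => [|c [g i] u IHu]; first by rewrite !linear0.
rewrite !linearP /= IHu; apply: congrZD.
rewrite ore_basis; elim: i => [|i IHi].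
  by rewrite mulr1 ore_comulg tens_mulE /= ore_antipodeg ore_ucg ore_grpV.
rewrite exprSr mulrA !(rmorphM _ _ x) /= ore_ucx mulr0 ore_comulx mulrDr.
rewrite linearD /= !tens_mul_antipodel /= IHi ore_antipodex.
have -> : ore_antipode 1 = 1 by rewrite -ore_grp1 ore_antipodeg invg1.
rewrite /unit_counit -!(scalerAl, scalerAr) !(mulr1, mul1r).
by rewrite mulNr -mulrA ore_grpV mulr1 scalerN addNr.
Qed.

Lemma ore_antipoder u :
  tens_mul idfun ore_antipode (ore_comul u) = unit_counit ore_counit u.
Proof.
elim/talg_ind: u => [|c [g i] u IHu]; first by rewrite !linear0.
rewrite !linearP /= IHu; apply: congrZD.
rewrite ore_basis !rmorphM /= ore_comulg tens_mul_antipoder /=.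
rewrite ore_ucg mul1r ore_antipodeg.
suff -> : tens_mul idfun ore_antipode (ore_comul (x ^+ i))
    = unit_counit ore_counit (x ^+ i).
  by rewrite /unit_counit -scalerAr -scalerAl mulr1 ore_grpVr.
have S1 : ore_antipode 1 = 1 by rewrite -ore_grp1 ore_antipodeg invg1.
elim: i => [|i IHi].
  by rewrite !rmorph1 /= -tens1 tens_mulE /= S1 mulr1.
rewrite exprS !(rmorphM _ x) /= ore_ucx mul0r ore_comulx mulrDl.
rewrite linearD /= !tens_mul_antipoder /= IHi ore_antipodex ore_antipodeg mul1r.
rewrite /unit_counit -scalerAr -!scalerAl mulr1 mul1r.
by rewrite scalerN addrN.
Qed.

Definition hopf_ore : hopf k :=
  Hopf ore_comulA ore_counitl ore_counitr ore_antipodel ore_antipoder.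

End HopfOre.

(* The additive extension of a map to the free abelian group on K. *)
HB.lock Definition zlin (K : choiceType) (W : zmodType) (f : K -> W)
    (z : {malg int[K]}) : W :=
  \sum_(p <- msupp z) f p *~ z@_p.
Arguments zlin {K W} f z.

Section AdditiveExtension.
Variables (K : choiceType) (W : zmodType) (f : K -> W).

Lemma zlinw (d : {fset K}) z : (msupp z `<=` d)%fset ->
  zlin f z = \sum_(p <- d) f p *~ z@_p.
Proof.
by move=> zd; rewrite unlock; apply: big_fset_incl => // p _ /mcoeff_outdom ->.
Qed.

Fact zlin_is_zmod_morphism : zmod_morphism (zlin f).
Proof.
move=> z w; set d := (msupp z `|` msupp w)%fset.
have sz : (msupp z `<=` d)%fset by rewrite fsubsetUl.
have sw : (msupp w `<=` d)%fset by rewrite fsubsetUr.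
rewrite (zlinw sz) (zlinw sw) (zlinw (msuppB_le z w)) -sumrB.
by apply: eq_bigr => p _; rewrite mcoeffB mulrzBr.
Qed.
HB.instance Definition _ :=
  GRing.isZmodMorphism.Build {malg int[K]} W (zlin f) zlin_is_zmod_morphism.

Lemma zlinE p : zlin f << (1 : int) *g p >> = f p.
Proof. by rewrite (zlinw msuppU_le) big_seq_fset1 mcoeffUU. Qed.

End AdditiveExtension.

Lemma eq_zlin (K : choiceType) (W : zmodType)
    (f h : {additive {malg int[K]} -> W}) :
  (forall p, f << (1 : int) *g p >> = h << (1 : int) *g p >>) -> f =1 h.
Proof.
move=> fh z; rewrite [z]monalgE !raddf_sum; apply: eq_bigr => p _.
have -> : << z@_p *g p >> = << (1 : int) *g p >> *~ z@_p :> {malg int[K]}.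
  by rewrite -raddfMz /= -mulrzr mul1r intz.
by rewrite !raddfMz fh.
Qed.

(* The extension of scalars B (x)_A V along a ring morphism phi : A -> B: the *)
(* quotient of the free abelian group on B * V by the subgroup generated by   *)
(* the relations of bilinearity and (b phi(s), v) = (b, s v).                 *)
Section ExtensionOfScalars.
Variables (A B : nzRingType) (phi : {rmorphism A -> B}) (V : lmodType A).

Local Notation F := {malg int[(B * V)%type]}.

Definition pregen (b : B) (v : V) : F := << (1 : int) *g (b, v) >>.

Inductive ext_rel : F -> Prop :=
| ExtRel0 : ext_rel 0
| ExtRelB z w : ext_rel z -> ext_rel w -> ext_rel (z - w)
| ExtRelDl b c v : ext_rel (pregen (b + c) v - pregen b v - pregen c v)
| ExtRelDr b v w : ext_rel (pregen b (v + w) - pregen b v - pregen b w)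
| ExtRelM b (s : A) v : ext_rel (pregen (b * phi s) v - pregen b (s *: v)).

Definition ext_pred : {pred F} := fun z => `[< ext_rel z >].

Fact ext_pred_zmod_closed : zmod_closed ext_pred.
Proof.
split=> [|z w /asboolP zr /asboolP wr]; apply/asboolP; first exact: ExtRel0.
exact: ExtRelB.
Qed.
HB.instance Definition _ := GRing.isZmodClosed.Build F
  ext_pred ext_pred_zmod_closed.

Definition ext_scalars : Type := Quotient.quot ext_pred.
HB.instance Definition _ := GRing.Zmodule.on ext_scalars.
HB.instance Definition _ := Quotient.on ext_scalars.

Definition ext_pi (z : F) : ext_scalars := (\pi_(Quotient.quot ext_pred) z)%qT.

Definition ext_tens (b : B) (v : V) : ext_scalars := ext_pi (pregen b v).

Lemma ext_piP z w : ext_pi z = ext_pi w <-> ext_rel (z - w).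
Proof.
have E : ((\pi_(Quotient.quot ext_pred) z)%qT
    == (\pi_(Quotient.quot ext_pred) w)%qT) = (z - w \in ext_pred).
  by rewrite Quotient.idealrBE.
split=> [/eqP|zw]; first by rewrite E => /asboolP.
by apply/eqP; rewrite E; apply/asboolP.
Qed.

Fact ext_pi_is_zmod_morphism : zmod_morphism ext_pi.
Proof. by move=> z w; rewrite /ext_pi !piE. Qed.
HB.instance Definition _ :=
  GRing.isZmodMorphism.Build F ext_scalars ext_pi ext_pi_is_zmod_morphism.

Lemma ext_piK q : ext_pi (repr (q : Quotient.quot ext_pred)) = q.
Proof. by rewrite /ext_pi reprK. Qed.

(* The action b' (b (x) v) = b' b (x) v, on the free group and its quotient. *)
Definition pre_act (b : B) : F -> F :=
  zlin (fun p : B * V => pregen (b * p.1) p.2).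
HB.instance Definition _ b := GRing.Additive.copy (pre_act b) (zlin _).

Lemma pre_actE b c v : pre_act b (pregen c v) = pregen (b * c) v.
Proof. by rewrite /pre_act zlinE. Qed.

Lemma pre_act_rel b z : ext_rel z -> ext_rel (pre_act b z).
Proof.
elim=> [|z' w _ IHz _ IHw|c d v|c v w|c s v].
- by rewrite raddf0; exact: ExtRel0.
- by rewrite raddfB; exact: ExtRelB.
- by rewrite !raddfB /= !pre_actE mulrDr; exact: ExtRelDl.
- by rewrite !raddfB /= !pre_actE; exact: ExtRelDr.
- by rewrite !raddfB /= !pre_actE mulrA; exact: ExtRelM.
Qed.

Definition ext_scale (b : B) (q : ext_scalars) : ext_scalars :=
  ext_pi (pre_act b (repr (q : Quotient.quot ext_pred))).

Lemma ext_scaleE b z : ext_scale b (ext_pi z) = ext_pi (pre_act b z).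
Proof.
apply/ext_piP; rewrite -raddfB; apply: pre_act_rel.
by apply/ext_piP; rewrite ext_piK.
Qed.

Fact ext_scaleA b c q : ext_scale b (ext_scale c q) = ext_scale (b * c) q.
Proof.
rewrite -[q]ext_piK !ext_scaleE; congr ext_pi.
apply: (eq_zlin (f := pre_act b \o pre_act c)) => -[d v] /=.
by rewrite -/(pregen _ _) !pre_actE mulrA.
Qed.

Fact ext_scale1 : left_id 1 ext_scale.
Proof.
move=> q; rewrite -[q]ext_piK ext_scaleE; congr ext_pi.
apply: (eq_zlin (h := idfun)) => -[d v] /=.
by rewrite -/(pregen _ _) pre_actE mul1r.
Qed.

Fact ext_scaleDr : right_distributive ext_scale +%R.
Proof.
move=> b p q; rewrite -[p]ext_piK -[q]ext_piK -raddfD !ext_scaleE.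
by rewrite !raddfD.
Qed.

Lemma ext_tensDl b c v : ext_tens (b + c) v = ext_tens b v + ext_tens c v.
Proof.
apply/eqP; rewrite -subr_eq0 -[X in _ - X]raddfD -raddfB opprD addrA /=.
by apply/eqP; rewrite -(raddf0 ext_pi); apply/ext_piP; rewrite subr0; exact: ExtRelDl.
Qed.

Lemma ext_tensDr b v w : ext_tens b (v + w) = ext_tens b v + ext_tens b w.
Proof.
by rewrite -raddfD; apply/ext_piP; rewrite opprD addrA; exact: ExtRelDr.
Qed.

Lemma ext_tensM b s v : ext_tens (b * phi s) v = ext_tens b (s *: v).
Proof. by apply/ext_piP; exact: ExtRelM. Qed.

Fact ext_scaleDl q : {morph ext_scale^~ q : b c / b + c}.
Proof.
move=> b c; rewrite -[q]ext_piK !ext_scaleE.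
set z := repr _; move: z => z.
apply: (eq_zlin (f := ext_pi \o pre_act (b + c))
  (h := (ext_pi \o pre_act b) \+ (ext_pi \o pre_act c))) => -[d v] /=.
by rewrite -/(pregen _ _) !pre_actE mulrDl -!/(ext_tens _ _) ext_tensDl.
Qed.

HB.instance Definition _ := GRing.Zmodule_isLmodule.Build B ext_scalars
  ext_scaleA ext_scale1 ext_scaleDr ext_scaleDl.

Lemma ext_tensZ b c v : b *: ext_tens c v = ext_tens (b * c) v.
Proof. by rewrite -[LHS]/(ext_scale _ _) ext_scaleE pre_actE. Qed.

End ExtensionOfScalars.

(* The underlying space of V_lam; lam only serves to select the kG-action. *)
Definition weight_line (k : fieldType) (G : groupType) (lam : character k G) :
  Type := k.
HB.instance Definition _ (k : fieldType) (G : groupType)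
  (lam : character k G) := GRing.Zmodule.on (weight_line lam).

Section WeightModules.
Variables (k : fieldType) (G : groupType).

Section WeightLine.
Variable lam : character k G.
Local Notation V := (weight_line lam).

Definition char_lin : talg (grpT k G) -> k^o :=
  tlin (fun g : tw_index (grpT k G) => lam g : k^o).
HB.instance Definition _ := GRing.Linear.copy char_lin (tlin _).

Fact char_lin_monoid_morphism : monoid_morphism char_lin.
Proof.
apply: tlin_monoid_morphism => [|g h]; first exact: (char1 lam).
by rewrite /= scale1r charM.
Qed.
HB.instance Definition _ := GRing.isMonoidMorphism.Build (talg (grpT k G)) k^o
  char_lin char_lin_monoid_morphism.


Definition weight_line_scale (u : talg (grpT k G)) (c : V) : V := (char_lin u : k) * (c : k).

Fact weight_line_scaleA u v c :
  weight_line_scale u (weight_line_scale v c) = weight_line_scale (u * v) c.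
Proof. by rewrite /weight_line_scale rmorphM mulrA. Qed.
Fact weight_line_scale1 : left_id 1 weight_line_scale.
Proof. by move=> c; rewrite /weight_line_scale rmorph1 mul1r. Qed.
Fact weight_line_scaleDr : right_distributive weight_line_scale +%R.
Proof. by move=> u c d; rewrite /weight_line_scale mulrDr. Qed.
Fact weight_line_scaleDl c : {morph weight_line_scale^~ c : u v / u + v}.
Proof. by move=> u v; rewrite /weight_line_scale raddfD mulrDl. Qed.

HB.instance Definition _ := GRing.Zmodule_isLmodule.Build (talg (grpT k G))
  V weight_line_scaleA weight_line_scale1 weight_line_scaleDr
  weight_line_scaleDl.

End WeightLine.

Variables (eta : character k G) (a : G).
Hypothesis a_central : forall g : G, (a * g = g * a)%g.

Local Notation H := (hopf_alg (hopf_ore eta a_central)).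

(* The inclusion of H_0 = kG in H. *)
Definition grp_incl : talg (grpT k G) -> H :=
  tlin (fun g : tw_index (grpT k G) => ore_grp eta g).
HB.instance Definition _ := GRing.Linear.copy grp_incl (tlin _).

Fact grp_incl_monoid_morphism : monoid_morphism grp_incl.
Proof.
apply: tlin_monoid_morphism => [|g h]; first exact: ore_grp1.
by rewrite /= scale1r ore_grpM.
Qed.
HB.instance Definition _ := GRing.isMonoidMorphism.Build (talg (grpT k G)) H
  grp_incl grp_incl_monoid_morphism.

(* M(lam) = H (x)_(H_0) V_lam. *)
Definition verma (lam : character k G) : lmodType H :=
  ext_scalars grp_incl (weight_line lam).

(* An H-module is an lmodType over the ring H; k acts on it through c |-> c 1. *)
Definition weight_vector (M : lmodType H) (lam : character k G) (v : M) :=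
  forall g : G, (ore_grp eta g : H) *: v = (lam g)%:A *: v.

(* M is the sum of its weight spaces, and this sum is direct. *)
Definition weight_module (M : lmodType H) : Prop :=
  (forall v : M, exists (n : nat) (mu : 'I_n -> character k G) (w : 'I_n -> M),
     (forall i, weight_vector (mu i) (w i)) /\ v = \sum_(i < n) w i) /\
  (forall (n : nat) (mu : 'I_n -> character k G) (w : 'I_n -> M),
     injective mu -> (forall i, weight_vector (mu i) (w i)) ->
     \sum_(i < n) w i = 0 -> forall i, w i = 0).

End WeightModules.

(* Projective objects of the full subcategory of A-modules with objects C. *)
Section Projective.
Variables (A : nzRingType) (C : lmodType A -> Prop).

(* Epimorphisms of C in the categorical sense. *)
Definition epi_in (M N : lmodType A) (f : {linear M -> N}) : Prop :=
  forall (P : lmodType A) (u v : {linear N -> P}),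
    C P -> (forall x, u (f x) = v (f x)) -> forall y, u y = v y.

Definition projective_in (P : lmodType A) : Prop :=
  C P /\
  forall (M N : lmodType A) (f : {linear M -> N}) (h : {linear P -> N}),
    C M -> C N -> epi_in f ->
    exists l : {linear P -> M}, forall x, f (l x) = h x.

End Projective.

(* Main.v *)
Require Import Defs.
From HB Require Import structures.
From mathcomp Require Import all_boot all_order all_algebra.
From mathcomp Require Import generic_quotient ring_quotient.
From mathcomp.multinomials Require Import monalg.
From mathcomp.classical Require Import boolp.

Set Implicit Arguments.
Unset Strict Implicit.
Unset Printing Implicit Defensive.

Import GRing.Theory.
Local Open Scope ring_scope.

(** Two facts combine. By Frobenius reciprocity, a morphism out of the Verma
    module M(lam) = H (x)_(kG) V_lam is the same thing as a vector of weight
    lam in the target, namely the image of v_lam = 1 (x) 1 ([verma_lift],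
    [verma_ext]). And an epimorphism f : M -> N of weight modules maps the
    lam-weight space of M onto that of N ([weight_vector_lift]). So h(v_lam)
    has a preimage v of weight lam, and the morphism sending v_lam to v
    lifts h.

    The second fact rests on the linear independence of weight vectors, in
    the form [weight_vector_sum_eq0]: a vector of weight lam that is a sum of
    vectors of weights other than lam vanishes. If f(v) = y with y of weight
    lam and v a sum of weight vectors, the summands of v of weight lam
    already map to y, because the remaining ones contribute to f(v) a vector
    that is of weight lam and also a sum of vectors of other weights.

    Epimorphisms are meant in the categorical sense, so their surjectivity
    has to be proved ([epi_in_surj]): weight modules are closed under
    quotients, hence the cokernel of f is a test object, on which the
    projection agrees with 0 after composition with f.

    That M(lam) is a weight module comes from the sums of weight vectors
    forming an H-submodule of any module: x shifts weights by the character
    eta^-1, where x g = eta(g) g x, and each g in G preserves weight spaces.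
    This submodule contains the generator of M(lam). The same independence
    statement makes the sum of weight spaces direct in every H-module, which
    leaves only generation to be checked ([weight_moduleP]). *)

(** * Cokernels and categorical epimorphisms *)

Section Cokernel.
Variables (A : nzRingType) (M N : lmodType A) (f : {linear M -> N}).

Definition im_pred : {pred N} := fun y => `[< exists x, f x = y >].

Fact im_pred_zmod_closed : zmod_closed im_pred.
Proof.
split=> [|y z /asboolP[x <-] /asboolP[x' <-]]; apply/asboolP.
  by exists 0; rewrite raddf0.
by exists (x - x'); rewrite raddfB.
Qed.
HB.instance Definition _ := GRing.isZmodClosed.Build N
  im_pred im_pred_zmod_closed.

Definition coker : Type := Quotient.quot im_pred.
HB.instance Definition _ := GRing.Zmodule.on coker.

Definition coker_pi (y : N) : coker := (\pi_(Quotient.quot im_pred) y)%qT.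

Lemma coker_piP y z : coker_pi y = coker_pi z <-> exists x, f x = y - z.
Proof.
have E : ((\pi_(Quotient.quot im_pred) y)%qT
    == (\pi_(Quotient.quot im_pred) z)%qT) = (y - z \in im_pred).
  by rewrite Quotient.idealrBE.
split=> [/eqP|yz]; first by rewrite E => /asboolP.
by apply/eqP; rewrite E; apply/asboolP.
Qed.

Fact coker_pi_is_zmod_morphism : zmod_morphism coker_pi.
Proof. by move=> y z; rewrite /coker_pi !piE. Qed.
HB.instance Definition _ :=
  GRing.isZmodMorphism.Build N coker coker_pi coker_pi_is_zmod_morphism.

Lemma coker_pi_eq0 y : coker_pi y = 0 <-> exists x, f x = y.
Proof.
by rewrite -(raddf0 coker_pi) -[in X in _ <-> X](subr0 y); apply: coker_piP.
Qed.

Definition coker_repr (q : coker) : N := repr (q : Quotient.quot im_pred).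

Lemma coker_piK q : coker_pi (coker_repr q) = q.
Proof. by rewrite /coker_pi /coker_repr reprK. Qed.

Definition coker_scale (s : A) (q : coker) : coker := coker_pi (s *: coker_repr q).

Lemma coker_scaleE s y : coker_scale s (coker_pi y) = coker_pi (s *: y).
Proof.
have /coker_piP[x fx] := coker_piK (coker_pi y).
by apply/coker_piP; exists (s *: x); rewrite linearZ /= fx scalerBr.
Qed.

Fact coker_scaleA s t q : coker_scale s (coker_scale t q) = coker_scale (s * t) q.
Proof. by rewrite -[q]coker_piK !coker_scaleE scalerA. Qed.
Fact coker_scale1 : left_id 1 coker_scale.
Proof. by move=> q; rewrite -[q]coker_piK coker_scaleE scale1r. Qed.
Fact coker_scaleDr : right_distributive coker_scale +%R.
Proof.
move=> s p q; rewrite -[p]coker_piK -[q]coker_piK -raddfD !coker_scaleE.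
by rewrite scalerDr raddfD.
Qed.
Fact coker_scaleDl q : {morph coker_scale^~ q : s t / s + t}.
Proof.
by move=> s t; rewrite -[q]coker_piK !coker_scaleE scalerDl raddfD.
Qed.
HB.instance Definition _ := GRing.Zmodule_isLmodule.Build A coker
  coker_scaleA coker_scale1 coker_scaleDr coker_scaleDl.

Fact coker_pi_scalable : scalable coker_pi.
Proof. by move=> s y; rewrite -coker_scaleE. Qed.
HB.instance Definition _ :=
  GRing.isScalable.Build A N coker *:%R coker_pi coker_pi_scalable.

End Cokernel.

(** Compare the projection to the cokernel with the zero map: they agree after
    composition with f, hence everywhere. *)
Lemma epi_in_surj (A : nzRingType) (C : lmodType A -> Prop) (M N : lmodType A)
    (f : {linear M -> N}) :
  (forall (Q : lmodType A) (p : {linear N -> Q}),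
     (forall q, exists y, p y = q) -> C Q) ->
  epi_in C f -> forall y, exists x, f x = y.
Proof.
move=> Cquo epi_f y.
have Ck : C (coker f).
  apply: (Cquo _ (coker_pi f)) => q.
  by exists (coker_repr q); apply: coker_piK.
apply/coker_pi_eq0; apply: (epi_f _ (coker_pi f) \0 Ck) => x /=.
by apply/coker_pi_eq0; exists x.
Qed.

(** * The universal property of the extension of scalars *)

Section ExtensionOfScalars.
Variables (A B : nzRingType) (phi : {rmorphism A -> B}) (V : lmodType A).

Local Notation E := (ext_scalars phi V).
Local Notation "b ⊗ v" := (ext_tens phi b v) (at level 40).

(** Pure tensors generate additively. Closure under differences is asked for
    because it yields 0, opposites and sums at once. *)
Lemma ext_scalars_ind (Q : E -> Prop) :
  (forall b v, Q (b ⊗ v)) -> (forall p q, Q p -> Q q -> Q (p - q)) ->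
  forall q, Q q.
Proof.
move=> Qtens QB.
have Q0 : Q 0 by rewrite -(subrr (0 ⊗ 0)); exact: QB.
have QN p : Q p -> Q (- p) by rewrite -sub0r; exact: QB.
have QD p q : Q p -> Q q -> Q (p + q) by move=> ? ?; rewrite -[q]opprK; auto.
have QM n p : Q p -> Q (p *+ n).
  by move=> Qp; elim: n => [|n IHn]; rewrite ?mulr0n ?mulrS; auto.
move=> q; rewrite -[q]ext_piK; set z := repr _.
rewrite [z]monalgE raddf_sum; apply: big_ind => // -[b v] _.
have -> : << z@_(b, v) *g (b, v) >> = pregen b v *~ z@_(b, v).
  by rewrite -raddfMz /= -mulrzr mul1r intz.
rewrite raddfMz /= -/(b ⊗ v).
case: (z@_ _) => n; [exact/QM/Qtens | exact/QN/QM/Qtens].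
Qed.

Section Lift.
Variables (M : lmodType B) (t : {additive V -> M}).
Hypothesis tZ : forall s v, t (s *: v) = phi s *: t v.

Let pre_lift : {malg int[(B * V)%type]} -> M := zlin (fun p => p.1 *: t p.2).
#[local] HB.instance Definition _ := GRing.Additive.copy pre_lift (zlin _).

Let pre_liftE b v : pre_lift (pregen b v) = b *: t v.
Proof. by rewrite /pre_lift zlinE. Qed.

Let pre_lift_rel z : ext_rel phi z -> pre_lift z = 0.
Proof.
elim=> [|z' w _ IHz _ IHw|b c v|b v w|b s v]; first exact: raddf0.
- by rewrite raddfB /= IHz IHw subrr.
- by rewrite !raddfB /= !pre_liftE scalerDl [_ + c *: _]addrC addrK subrr.
- by rewrite !raddfB /= !pre_liftE raddfD scalerDr [_ + b *: t w]addrC addrK subrr.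
- by rewrite raddfB /= !pre_liftE tZ scalerA subrr.
Qed.

Let ext_lift (q : E) : M :=
  pre_lift (repr (q : Quotient.quot (ext_pred phi (V := V)))).

Let ext_lift_pi z : ext_lift (ext_pi phi z) = pre_lift z.
Proof.
apply/eqP; rewrite -subr_eq0 -raddfB; apply/eqP/pre_lift_rel/ext_piP.
exact: ext_piK.
Qed.

Let ext_liftE b v : ext_lift (b ⊗ v) = b *: t v.
Proof. by rewrite ext_lift_pi pre_liftE. Qed.

Let ext_lift_is_zmod_morphism : zmod_morphism ext_lift.
Proof.
by move=> p q; rewrite -[p]ext_piK -[q]ext_piK -raddfB !ext_lift_pi raddfB.
Qed.
#[local] HB.instance Definition _ :=
  GRing.isZmodMorphism.Build E M ext_lift ext_lift_is_zmod_morphism.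

Let ext_lift_scalable : scalable ext_lift.
Proof.
move=> b; elim/ext_scalars_ind=> [c v|p q IHp IHq].
  by rewrite ext_tensZ !ext_liftE scalerA.
by rewrite scalerBr !raddfB /= IHp IHq.
Qed.
#[local] HB.instance Definition _ :=
  GRing.isScalable.Build B E M *:%R ext_lift ext_lift_scalable.

(** Frobenius reciprocity: the additive map (b, v) |-> b t(v) on the free
    group kills the defining relations of the tensor product, the last of them
    because t is phi-semilinear. *)
Lemma ext_scalars_lift :
  exists l : {linear E -> M}, forall b v, l (b ⊗ v) = b *: t v.
Proof. by exists ext_lift; exact: ext_liftE. Qed.

End Lift.
End ExtensionOfScalars.

(** * Weight vectors *)

Section Weights.
Variables (k : fieldType) (G : groupType).

Lemma eq_character (mu nu : character k G) : mu =1 nu -> mu = nu.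
Proof.
case: mu nu => mu mM m0 [nu nM n0] /= /funext E.
by case: _ / E in nM n0 *; congr Character; apply: Prop_irrelevance.
Qed.

Fact char_mul_M (mu nu : character k G) (g h : G) :
  mu (g * h)%g * nu (g * h)%g = mu g * nu g * (mu h * nu h).
Proof. by rewrite !charM mulrACA. Qed.
Fact char_mul_neq0 (mu nu : character k G) (g : G) : mu g * nu g != 0.
Proof. by rewrite mulf_neq0 ?char_neq0. Qed.
Definition char_mul (mu nu : character k G) : character k G :=
  Character (char_mul_M mu nu) (char_mul_neq0 mu nu).

Variables (eta : character k G) (a : G).
Hypothesis a_central : forall g : G, (a * g = g * a)%g.

Local Notation H := (hopf_alg (hopf_ore eta a_central)).
Local Notation gl g := (ore_grp eta g : H).
Local Notation x := (ore_x eta : H).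
Local Notation weight := (@weight_vector k G eta a a_central _).

Section WeightVectors.
Variable M : lmodType H.
Implicit Types (v w : M) (mu nu : character k G) (c : k).

(** The field k acts on an H-module through the central elements c 1, so the
    rules of a k-vector space are needed in this form. *)
Lemma scalar_actC c (u : H) v : u *: (c%:A *: v) = c%:A *: (u *: v).
Proof. by rewrite !scalerA mulr_algl mulr_algr. Qed.

Lemma scalar_actA c d v : c%:A *: (d%:A *: v) = (c * d)%:A *: v.
Proof. by rewrite [LHS]scalerA mulr_algl [c *: _]scalerA. Qed.

Lemma scalar_actB c d v : (c - d)%:A *: v = c%:A *: v - d%:A *: v.
Proof. by rewrite [(c - d)%:A]scalerBl [LHS]scalerBl. Qed.

Lemma weight_vector0 mu : weight mu (0 : M).
Proof. by move=> g; rewrite !scaler0. Qed.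

Lemma weight_vectorD mu v w : weight mu v -> weight mu w -> weight mu (v + w).
Proof. by move=> wv ww g; rewrite !scalerDr wv ww. Qed.

Lemma weight_vectorZ mu c v : weight mu v -> weight mu (c%:A *: v).
Proof. by move=> wv g; rewrite scalar_actC wv scalar_actC. Qed.

Lemma weight_vector_grp mu v g : weight mu v -> weight mu (gl g *: v).
Proof. by move=> wv; rewrite wv; apply: weight_vectorZ. Qed.

(** From x g = eta(g) g x follows g x = eta(g)^-1 x g, hence the shift of the
    weight. *)
Lemma weight_vector_x mu v :
  weight mu v -> weight (char_mul mu (char_inv eta)) (x *: v).
Proof.
move=> wv g.
have -> : gl g *: (x *: v) = (eta g)^-1%:A *: (x *: (gl g *: v)).
  rewrite !scalerA mulr_algl; congr (_ *: _).
  by rewrite [x * _]ore_xg scalerA mulVf ?scale1r ?char_neq0.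
by rewrite wv (scalar_actC _ x) scalar_actA mulrC.
Qed.

(** Dedekind's argument. If the first summand has weight mu, choose g with
    lam(g) <> mu(g); applying g - mu(g) kills that summand, rescales all other
    vectors, and multiplies v by the nonzero scalar lam(g) - mu(g). Induction
    on the number of summands concludes. The weights mu_i may repeat: only
    their being different from lam matters, which suits arbitrary
    decompositions into weight vectors. *)
Lemma weight_vector_sum_eq0 (I : Type) (s : seq I) (P : pred I)
    (mu : I -> character k G) (w : I -> M) lam v :
  weight lam v -> (forall i, P i -> weight (mu i) (w i)) ->
  (forall i, P i -> mu i <> lam) -> v = \sum_(i <- s | P i) w i -> v = 0.
Proof.
move=> + ww mu_lam; elim: s v w ww => [|i s IHs] v w ww wv.
  by rewrite big_nil.
rewrite big_cons; case: ifP => [Pi vE|_]; last exact: IHs.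
have [g neq_g] : exists g, lam g - mu i g != 0.
  apply: contrapT => eq_mu; apply: (mu_lam i Pi); apply: eq_character => g.
  apply/eqP; rewrite eq_sym -subr_eq0; apply: contra_notT eq_mu => ne.
  by exists g.
have scal nu (u : M) : weight nu u ->
    (gl g - (mu i g)%:A) *: u = (nu g - mu i g)%:A *: u.
  by move=> wu; rewrite scalerBl wu scalar_actB.
(* v multiplied by this scalar is a sum over the shorter sequence s. *)
have : (lam g - mu i g)%:A *: v = 0.
  apply: (IHs _ (fun j => (mu j g - mu i g)%:A *: w j)) => [j Pj||].
  - exact/weight_vectorZ/ww.
  - exact: weight_vectorZ.
  rewrite -(scal lam) // vE scalerDr (scal (mu i)); last exact: ww.
  rewrite subrr scale0r scale0r add0r scaler_sumr; apply: eq_bigr => j Pj.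
  by rewrite (scal (mu j)) //; apply: ww.
move/(congr1 (fun u => (lam g - mu i g)^-1%:A *: u)).
by rewrite scaler0 scalar_actA mulVf // scale1r scale1r.
Qed.

(** Move one summand to the other side: w_i is a vector of weight mu_i and a
    sum of vectors of the other weights. *)
Lemma weight_vectors_free n (mu : 'I_n -> character k G) (w : 'I_n -> M) :
  injective mu -> (forall i, weight (mu i) (w i)) ->
  \sum_(i < n) w i = 0 -> forall i, w i = 0.
Proof.
move=> mu_inj ww sum0 i.
apply: (@weight_vector_sum_eq0 _ (index_enum 'I_n) (predC1 i) mu
  (fun j => - w j) (mu i)) => [//|j _|j /= ji /mu_inj/eqP|].
- by rewrite -scaleN1r -[-1](scaleN1r (1 : H)); apply: weight_vectorZ.
- exact/negP.
- by move: sum0; rewrite (bigD1 i) //= sumrN => /eqP; rewrite addr_eq0 => /eqP.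
Qed.

Definition weight_sum (v : M) : Prop :=
  exists (n : nat) (mu : 'I_n -> character k G) (w : 'I_n -> M),
    (forall i, weight (mu i) (w i)) /\ v = \sum_(i < n) w i.

Lemma weight_moduleP :
  @weight_module k G eta a a_central M <-> forall v, weight_sum v.
Proof.
split=> [[]//|wM]; split=> // n mu w; exact: weight_vectors_free.
Qed.

Lemma weight_sum_vector mu v : weight mu v -> weight_sum v.
Proof.
by move=> wv; exists 1%N, (fun=> mu), (fun=> v); rewrite big_ord1.
Qed.

Lemma weight_sum0 : weight_sum 0.
Proof. exact/(@weight_sum_vector eta)/weight_vector0. Qed.

Lemma weight_sumD v w : weight_sum v -> weight_sum w -> weight_sum (v + w).
Proof.
move=> [m [mu [e [we ->]]]] [n [nu [f [wf ->]]]].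
exists (m + n)%N,
  (fun i => match split i with inl j => mu j | inr j => nu j end),
  (fun i => match split i with inl j => e j | inr j => f j end).
split=> [i|]; first by case: split.
rewrite big_split_ord /=; congr (_ + _); apply: eq_bigr => i _.
  by have := unsplitK (inl i : 'I_m + 'I_n) => /= ->.
by have := unsplitK (inr i : 'I_m + 'I_n) => /= ->.
Qed.

(** The map th keeps track of the change of weights: the identity for scalars
    and elements of G, the shift by eta^-1 for x. *)
Lemma weight_sum_act (u : H) (th : character k G -> character k G) v :
  (forall mu w, weight mu w -> weight (th mu) (u *: w)) ->
  weight_sum v -> weight_sum (u *: v).
Proof.
move=> u_th [n [mu [w [ww ->]]]]; exists n, (th \o mu), (fun i => u *: w i).
by split=> [i|]; [apply: u_th | rewrite scaler_sumr].
Qed.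

(** It is enough to act by the factors c, g and x of the basis elements
    g x^i of H, each of which sends weight vectors to weight vectors. *)
Lemma weight_sumZ (u : H) v : weight_sum v -> weight_sum (u *: v).
Proof.
move=> wv; elim/talg_ind: u => [|c [g i] u IHu].
  by rewrite scale0r; exact: weight_sum0.
rewrite scalerDl; apply: weight_sumD => //.
rewrite -[c *: _]mulr_algl -scalerA.
apply: (weight_sum_act (th := id)) => [mu w|]; first exact: weight_vectorZ.
rewrite [tb _]ore_basis -scalerA.
apply: (weight_sum_act (th := id)) => [mu w|]; first exact: weight_vector_grp.
elim: i => [|i IHi]; first by rewrite scale1r.
rewrite exprS -scalerA; apply: weight_sum_act IHi => mu w.
exact: weight_vector_x.
Qed.

End WeightVectors.

Lemma weight_vector_linear (M N : lmodType H) (f : {linear M -> N}) mu v :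
  weight mu v -> weight mu (f v).
Proof. by move=> wv g; rewrite -linearZ /= wv linearZ. Qed.

Lemma weight_module_quotient (M N : lmodType H) (f : {linear M -> N}) :
  (forall y, exists v, f v = y) ->
  @weight_module k G eta a a_central M -> @weight_module k G eta a a_central N.
Proof.
move=> f_surj /weight_moduleP wM; apply/weight_moduleP => y.
have [v <-] := f_surj y; have [n [mu [w [ww ->]]]] := wM v.
exists n, mu, (f \o w); split=> [i|]; last by rewrite raddf_sum.
exact: weight_vector_linear.
Qed.

(** Take any preimage, decompose it into weight vectors, and keep the summands
    of weight lam. The discarded summands map to a vector of weight lam, which
    vanishes by independence of weights. *)
Lemma weight_vector_lift (M N : lmodType H) (f : {linear M -> N}) lam y :
  @weight_module k G eta a a_central M -> (forall y, exists v, f v = y) ->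
  weight lam y -> exists2 v, weight lam v & f v = y.
Proof.
move=> /weight_moduleP wM f_surj wy.
have [v fv] := f_surj y; have [n [mu [w [ww vE]]]] := wM v.
pose is_lam i := `[< mu i = lam >].
have wl : weight lam (\sum_(i | is_lam i) w i).
  apply: big_ind => [||i /asboolP<-//]; first exact: weight_vector0.
  exact: weight_vectorD.
exists (\sum_(i | is_lam i) w i) => //.
apply/eqP; rewrite eq_sym -subr_eq0; apply/eqP.
apply: (@weight_vector_sum_eq0 _ _ (index_enum 'I_n) (predC is_lam) mu (f \o w) lam).
- rewrite -[- _]scaleN1r -[-1](scaleN1r (1 : H)).
  by apply: weight_vectorD => //; apply/weight_vectorZ/weight_vector_linear.
- by move=> i _; apply: weight_vector_linear.
- by move=> i /asboolP.
by rewrite -fv -raddfB vE (bigID is_lam) /= addrC addrK raddf_sum.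
Qed.

(** * Verma modules *)

Section Verma.
Variable lam : character k G.
Local Notation L := (weight_line lam).
Local Notation phi := (grp_incl eta a_central).

(** The generator v_lam = 1 (x) 1. *)
Definition verma_gen : verma eta a_central lam := ext_tens phi 1 ((1 : k) : L).

Lemma char_lin_grp g : char_lin lam (tb (T := grpT k G) g) = lam g.
Proof. by rewrite /char_lin tlinE. Qed.

Lemma char_lin_scalar (c : k) : char_lin lam c%:A = c.
Proof. by rewrite linearZ /= rmorph1; apply: mulr1. Qed.

(** Move g across the tensor sign, where it acts on V_lam by lam(g). *)
Lemma verma_weight_vector (c : L) :
  weight lam (ext_tens phi 1 c : verma eta a_central lam).
Proof.
move=> g; rewrite !ext_tensZ !mulr1.
have -> : gl g = phi (tb (T := grpT k G) g) by rewrite /grp_incl tlinE.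
have -> : (lam g)%:A = phi (lam g)%:A by rewrite linearZ /= rmorph1.
rewrite -[phi _]mul1r ext_tensM -[phi _]mul1r ext_tensM.
congr ext_tens.
rewrite -[LHS]/(weight_line_scale _ _) -[RHS]/(weight_line_scale _ _).
by rewrite /weight_line_scale char_lin_grp char_lin_scalar.
Qed.

(** b (x) c = b (1 (x) c) lies in the submodule generated by a weight vector. *)
Lemma verma_weight_module :
  @weight_module k G eta a a_central (verma eta a_central lam).
Proof.
apply/weight_moduleP; apply: ext_scalars_ind => [b c|p q wp wq].
  rewrite -[b]mulr1 -ext_tensZ.
  exact/weight_sumZ/weight_sum_vector/verma_weight_vector.
by apply: weight_sumD => //; rewrite -scaleN1r; apply: weight_sumZ.
Qed.

Section VermaLift.
Variables (M : lmodType H) (v : M).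
Hypothesis wv : weight lam v.

(** The map V_lam -> M sending 1 to v; [line_mapZ] is its kG-linearity, which
    says precisely that v has weight lam. *)
Definition line_map (c : L) : M := (c : k)%:A *: v.

Fact line_map_is_zmod_morphism : zmod_morphism line_map.
Proof. by move=> c d; exact: scalar_actB. Qed.
#[local] HB.instance Definition _ :=
  GRing.isZmodMorphism.Build L M line_map line_map_is_zmod_morphism.

Lemma line_mapZ s (c : L) : line_map (s *: c) = phi s *: line_map c.
Proof.
elim/talg_ind: s => [|e g s IHs]; first by rewrite linear0 !scale0r raddf0.
rewrite scalerDl raddfD /= IHs [phi (_ + _)]raddfD scalerDl /=; congr (_ + _).
rewrite -[X in _ = X *: _]/(phi _).
have -> : phi (e *: tb g) = e%:A * gl g.
  by rewrite mulr_algl linearZ /= /grp_incl tlinE.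
rewrite -[RHS]scalerA /line_map (scalar_actC _ (gl g)) wv.
rewrite !scalar_actA; congr (_%:A *: _).
rewrite -[LHS]/((char_lin lam _ : k) * c) linearZ /= char_lin_grp.
exact: mulrAC.
Qed.

Lemma verma_lift : exists l : {linear verma eta a_central lam -> M},
  l verma_gen = v.
Proof.
have [l lE] := ext_scalars_lift line_mapZ; exists l.
by rewrite lE /= /line_map !scale1r.
Qed.

End VermaLift.

Lemma verma_ext (N : lmodType H) (f h : {linear verma eta a_central lam -> N}) :
  f verma_gen = h verma_gen -> f =1 h.
Proof.
move=> fh; apply: ext_scalars_ind => [b c|p q IHp IHq]; last first.
  by rewrite !raddfB /= IHp IHq.
have -> : ext_tens phi b c = (b * phi (c : k)%:A) *: verma_gen.
  rewrite ext_tensZ mulr1 ext_tensM; congr ext_tens.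
  by rewrite -[RHS]/((char_lin lam _ : k) * 1) char_lin_scalar mulr1.
by rewrite !linearZ /= fh.
Qed.

End Verma.
End Weights.

Theorem lemma4p6 (k : fieldType) (G : groupType) (chi : character k G) (a : G)
    (a_central : forall g : G, (a * g = g * a)%g) (chi_a : chi a != 1%R)
    (lambda : character k G) :
  projective_in (@weight_module k G (char_inv chi) a a_central)
    (verma (char_inv chi) a_central lambda).
Proof.
split=> [|M N f h wM wN epi_f]; first exact: verma_weight_module.
have f_surj : forall y, exists v, f v = y.
  apply: epi_in_surj epi_f => Q p p_surj.
  exact: (weight_module_quotient p_surj).
have wh : weight_vector lambda
    (h (verma_gen (char_inv chi) a_central lambda)).
  exact/weight_vector_linear/verma_weight_vector.
have [v wv fv] := weight_vector_lift wM f_surj wh.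
have [l lv] := verma_lift wv.
exists l; apply: (verma_ext (f := f \o l)).
by rewrite /= lv.
Qed.
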